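(* Let $\mathfrak{G}=\langle\mathbb{N},\leqslant\rangle$ and let $L$ be a superintuitionistic predicate logic such that $\mathbf{QLC}\subseteq L\subseteq \mathsf{QSIL}(\mathfrak{G}\odot\mathbb{N})$. Then the fragment of the positive fragment $L^+$ of $L$ consisting of its formulas in the language with two individual variables, a single binary predicate letter, and infinitely many unary predicate letters is $\Sigma^0_1$-hard.
   Context: Language: $\mathcal{L}$ is the predicate language (no equality, no function symbols or constants) with countably many individual variables, countably many predicate letters of every arity (nullary ones are proposition letters), $\bot$, $\wedge,\vee,\to$, $\forall,\exists$; $\neg\varphi$ abbreviates $\varphi\to\bot$. A formula is positive if it contains no occurrence of $\bot$; for a logic $L$, $L^+$ is the set of positive formulas in $L$. Semantics: a Kripke frame is $\mathfrak{F}=\langle W,R\rangle$ with $W\neq\varnothing$ and $R$ a partial order on $W$ (only such intuitionistic frames are considered). An augmented frame over $\mathfrak{F}$ is $\mathfrak{F}_D=\langle W,R,D\rangle$ where $D$ assigns to each $w\in W$ a non-empty set $D_w$ with $D_u\subseteq D_w$ whenever $uRw$. $\mathfrak{F}\odot\mathcal{D}$ denotes the augmented frame over $\mathfrak{F}$ with $D_w=\mathcal{D}$ for all $w$. A model over $\mathfrak{F}_D$ has an interpretation $I$ with $I(w,P)\subseteq D_w^n$ for each $n$-ary letter $P$ and $I(w,P)\subseteq I(w',P)$ whenever $wRw'$. Truth at $w$: atoms according to $I(w,\cdot)$; $\bot$ never true; $\wedge,\vee$ pointwise; $\varphi\to\psi$ is true at $w$ iff for every $v$ with $wRv$, truth of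 $\varphi$ at $v$ implies truth of $\psi$ at $v$; $\forall x\,\varphi$ is true at $w$ iff for every $v$ with $wRv$ and every $a\in D_v$, $\varphi(a)$ is true at $v$; $\exists x\,\varphi$ is true at $w$ iff $\varphi(a)$ is true at $w$ for some $a\in D_w$. A formula is valid on $\mathfrak{F}_D$ if it is true at every world $w$ of every model over $\mathfrak{F}_D$ under every assignment of elements of $D_w$ to its free variables; it is valid on $\mathfrak{F}$ if it is valid on every augmented frame over $\mathfrak{F}$. $\mathsf{QSIL}(\mathfrak{F}_D)$ is the set of $\mathcal{L}$-formulas valid on $\mathfrak{F}_D$. Logics: $\mathbf{QInt}$ is the set of $\mathcal{L}$-formulas valid on every (intuitionistic) Kripke frame. A superintuitionistic predicate logic is a set of $\mathcal{L}$-formulas including $\mathbf{QInt}$ and closed under Modus Ponens, Substitution (of formulas for predicate letters), and Generalization. $\mathbf{QLC}$ is the smallest superintuitionistic predicate logic containing $(p\to q)\vee(q\to p)$, with $p,q$ proposition letters; it is known to coincide with the set of formulas valid on all Kripke frames whose relation is a linear order. Hardness is with respect to computable many-one reductions. *)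

(* Defs.v *)
From Stdlib Require Import Arith List Relations Cantor.
Import ListNotations.

(** Individual variables are natural numbers.  [Atom i xs] is the [i]-th
    predicate letter of arity [length xs] applied to the variables [xs]; thus a
    predicate letter is a pair (index, arity), and [Atom i [x]] and
    [Atom i [x; y]] involve different letters. *)
Inductive formula : Type :=
| Bot : formula
| Atom : nat -> list nat -> formula
| And : formula -> formula -> formula
| Or : formula -> formula -> formula
| Imp : formula -> formula -> formula
| All : nat -> formula -> formula
| Ex : nat -> formula -> formula.

Fixpoint fv (A : formula) : list nat :=
  match A with
  | Bot => []
  | Atom _ xs => xs
  | And B C | Or B C | Imp B C => fv B ++ fv C
  | All x B | Ex x B => remove Nat.eq_dec x (fv B)
  end.

Fixpoint positive (A : formula) : Prop :=
  match A with
  | Bot => False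
  | Atom _ _ => True
  | And B C | Or B C | Imp B C => positive B /\ positive C
  | All _ B | Ex _ B => positive B
  end.

(** The letters allowed are all the unary ones and the binary one of index 0; the
    variables, bound or free, are 0 and 1. *)
Fixpoint two_var_one_binary (A : formula) : Prop :=
  match A with
  | Bot => True
  | Atom i xs =>
      (length xs = 1 \/ (length xs = 2 /\ i = 0)) /\ Forall (fun x => x < 2) xs
  | And B C | Or B C | Imp B C => two_var_one_binary B /\ two_var_one_binary C
  | All x B | Ex x B => x < 2 /\ two_var_one_binary B
  end.

Definition update {T : Type} (a : nat -> T) (x : nat) (d : T) : nat -> T :=
  fun y => if Nat.eq_dec y x then d else a y.

Record frame : Type := {
  world :> Type;
  acc : relation world;
  acc_order : order world acc;
  world_inhabited : inhabited world
}.
Arguments acc {f}.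

Record augmented_frame (F : frame) : Type := {
  carrier : Type;
  dom : F -> carrier -> Prop;
  dom_nonempty : forall w, exists d, dom w d;
  dom_mono : forall u w, acc u w -> forall d, dom u d -> dom w d
}.
Arguments carrier {F}.
Arguments dom {F}.

Record model {F : frame} (FD : augmented_frame F) : Type := {
  interp : F -> nat -> list (carrier FD) -> Prop;
  interp_dom : forall w i ds, interp w i ds -> Forall (dom FD w) ds;
  interp_mono : forall u w, acc u w -> forall i ds, interp u i ds -> interp w i ds
}.
Arguments interp {F FD}.

Fixpoint force {F : frame} {FD : augmented_frame F} (M : model FD)
    (w : F) (a : nat -> carrier FD) (A : formula) : Prop :=
  match A with
  | Bot => False
  | Atom i xs => interp M w i (map a xs)
  | And B C => force M w a B /\ force M w a C
  | Or B C => force M w a B \/ force M w a C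
  | Imp B C => forall v, acc w v -> force M v a B -> force M v a C
  | All x B => forall v, acc w v -> forall d, dom FD v d -> force M v (update a x d) B
  | Ex x B => exists d, dom FD w d /\ force M w (update a x d) B
  end.

Definition QSIL {F : frame} (FD : augmented_frame F) (A : formula) : Prop :=
  forall (M : model FD) (w : F) (a : nat -> carrier FD),
    (forall x, In x (fv A) -> dom FD w (a x)) -> force M w a A.

Definition valid_frame (F : frame) (A : formula) : Prop :=
  forall FD : augmented_frame F, QSIL FD A.

Definition QInt (A : formula) : Prop := forall F : frame, valid_frame F A.

Definition constant_domain (F : frame) (T : Type) (t : T) : augmented_frame F :=
  {| carrier := T;
     dom := fun _ _ => True;
     dom_nonempty := fun _ => ex_intro _ t I;
     dom_mono := fun _ _ _ _ h => h |}.

Definition nat_frame : frame :=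
  {| world := nat;
     acc := le;
     acc_order := Build_order nat le Nat.le_refl Nat.le_trans Nat.le_antisymm;
     world_inhabited := inhabits 0 |}.

Definition avoid (x : nat) (l : list nat) : nat :=
  if in_dec Nat.eq_dec x l then S (list_max l) else x.

(** Capture-avoiding simultaneous substitution of variables for free variables. *)
Fixpoint rename (s : nat -> nat) (A : formula) : formula :=
  match A with
  | Bot => Bot
  | Atom i xs => Atom i (map s xs)
  | And B C => And (rename s B) (rename s C)
  | Or B C => Or (rename s B) (rename s C)
  | Imp B C => Imp (rename s B) (rename s C)
  | All x B =>
      let z := avoid x (map s (fv (All x B))) in All z (rename (update s x z) B)
  | Ex x B =>
      let z := avoid x (map s (fv (Ex x B))) in Ex z (rename (update s x z) B)
  end.

Fixpoint assign (ys zs : list nat) : nat -> nat :=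
  match ys, zs with
  | y :: ys', z :: zs' => update (assign ys' zs') y z
  | _, _ => fun x => x
  end.

(** [S i n = (ys, C)] means that [C(ys)] is substituted for the [i]-th letter of
    arity [n], where [ys] are the [n] distinct argument variables of [C].  The
    other free variables of [C] are parameters, which must not become bound. *)
Definition letter_subst : Type := nat -> nat -> list nat * formula.

Definition letter_subst_wf (S : letter_subst) : Prop :=
  forall i n, length (fst (S i n)) = n /\ NoDup (fst (S i n)).

Fixpoint params (S : letter_subst) (A : formula) : list nat :=
  match A with
  | Bot => []
  | Atom i xs =>
      let (ys, C) := S i (length xs) in
      filter (fun x => if in_dec Nat.eq_dec x ys then false else true) (fv C)
  | And B C | Or B C | Imp B C => params S B ++ params S C
  | All _ B | Ex _ B => params S B
  end.

(** [s] records the renaming of the bound variables met on the way down. *)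
Fixpoint subst_rec (S : letter_subst) (s : nat -> nat) (A : formula) : formula :=
  match A with
  | Bot => Bot
  | Atom i xs =>
      let (ys, C) := S i (length xs) in rename (assign ys (map s xs)) C
  | And B C => And (subst_rec S s B) (subst_rec S s C)
  | Or B C => Or (subst_rec S s B) (subst_rec S s C)
  | Imp B C => Imp (subst_rec S s B) (subst_rec S s C)
  | All x B =>
      let z := avoid x (map s (fv (All x B)) ++ params S B) in
      All z (subst_rec S (update s x z) B)
  | Ex x B =>
      let z := avoid x (map s (fv (Ex x B)) ++ params S B) in
      Ex z (subst_rec S (update s x z) B)
  end.

Definition subst (S : letter_subst) (A : formula) : formula :=
  subst_rec S (fun x => x) A.

Record superintuitionistic (L : formula -> Prop) : Prop := {
  si_QInt : forall A, QInt A -> L A;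
  si_mp : forall A B, L A -> L (Imp A B) -> L B;
  si_subst : forall S A, letter_subst_wf S -> L A -> L (subst S A);
  si_gen : forall x A, L A -> L (All x A)
}.

Definition linearity_axiom : formula :=
  let p := Atom 0 [] in let q := Atom 1 [] in Or (Imp p q) (Imp q p).

Definition QLC (A : formula) : Prop :=
  forall L : formula -> Prop, superintuitionistic L -> L linearity_axiom -> L A.

Definition positive_fragment (L : formula -> Prop) (A : formula) : Prop :=
  L A /\ positive A.

Definition restricted_fragment (L : formula -> Prop) (A : formula) : Prop :=
  positive_fragment L A /\ two_var_one_binary A.

(** Kleene's partial recursive functions; a program has no fixed arity, and is
    undefined on argument lists that are too short for it. *)
Inductive program : Type :=
| Zero : program
| Succ : program
| Proj : nat -> program
| Comp : program -> list program -> program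
| PrimRec : program -> program -> program
| Mu : program -> program.

Inductive eval : program -> list nat -> nat -> Prop :=
| eval_Zero : forall xs, eval Zero xs 0
| eval_Succ : forall x xs, eval Succ (x :: xs) (S x)
| eval_Proj : forall i xs x, nth_error xs i = Some x -> eval (Proj i) xs x
| eval_Comp : forall f gs xs ys z,
    Forall2 (fun g y => eval g xs y) gs ys ->
    eval f ys z -> eval (Comp f gs) xs z
| eval_PrimRec_0 : forall f g xs y,
    eval f xs y -> eval (PrimRec f g) (0 :: xs) y
| eval_PrimRec_S : forall f g n xs y z,
    eval (PrimRec f g) (n :: xs) y ->
    eval g (n :: y :: xs) z -> eval (PrimRec f g) (S n :: xs) z
| eval_Mu : forall f xs n,
    (forall m, m < n -> exists k, eval f (m :: xs) (S k)) ->
    eval f (n :: xs) 0 -> eval (Mu f) xs n.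

Definition computable (f : nat -> nat) : Prop :=
  exists p, forall n, eval p [n] (f n).

Definition computable2 (f : nat -> nat -> nat) : Prop :=
  exists p, forall n m, eval p [n; m] (f n m).

Definition Sigma01 (X : nat -> Prop) : Prop :=
  exists f, computable2 f /\ forall n, X n <-> exists m, f n m = 0.

Definition many_one_reducible (X Y : nat -> Prop) : Prop :=
  exists f, computable f /\ forall n, X n <-> Y (f n).

Definition Sigma01_hard (Y : nat -> Prop) : Prop :=
  forall X, Sigma01 X -> many_one_reducible X Y.

Fixpoint code_list (xs : list nat) : nat :=
  match xs with
  | [] => 0
  | x :: xs' => S (to_nat (x, code_list xs'))
  end.

Fixpoint code (A : formula) : nat :=
  match A with
  | Bot => to_nat (0, 0)
  | Atom i xs => to_nat (1, to_nat (i, code_list xs))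
  | And B C => to_nat (2, to_nat (code B, code C))
  | Or B C => to_nat (3, to_nat (code B, code C))
  | Imp B C => to_nat (4, to_nat (code B, code C))
  | All x B => to_nat (5, to_nat (x, code B))
  | Ex x B => to_nat (6, to_nat (x, code B))
  end.

Lemma code_list_inj xs ys : code_list xs = code_list ys -> xs = ys.
Proof.
  revert ys; induction xs as [|x xs IH]; intros [|y ys]; cbn [code_list];
    intros H; try discriminate; [reflexivity|].
  apply Nat.succ_inj, to_nat_inj in H. injection H as -> H.
  now rewrite (IH _ H).
Qed.

Lemma code_inj A B : code A = code B -> A = B.
Proof.
  revert B; induction A; intros []; cbn [code]; intros H;
    apply to_nat_inj in H; try discriminate; try reflexivity;
    apply (f_equal snd) in H; cbn [snd] in H; apply to_nat_inj in H;
    injection H; intros; subst; f_equal; auto using code_list_inj.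
Qed.

Definition codes (X : formula -> Prop) (n : nat) : Prop :=
  exists A, X A /\ n = code A.

(* Main.v *)
From Stdlib Require Import Arith List Lia Cantor Classical ClassicalEpsilon.
Import ListNotations.
Require Import Defs.

(** Given a program for [f], the unbounded search for an [m] with
    [f n m = 0] is a computation which halts exactly when [n] lies in the given Sigma^0_1 set.
    It is described by a positive formula [halting], built from unary letters and
    two variables, which belongs to QInt, hence to [L], if the search halts
    ([halting_valid]), and which fails on the natural numbers with constant
    domain, hence is not in [L], if it does not ([halting_refuted]).

    Falsity is replaced by a closed positive formula [falsum].  At a world [w] not
    forcing [falsum], an implication into it acts as a negation, and the formula
    [P(x) <-> Q(y)] says that the up-sets of worlds above [w] at which [P(x)] and
    [Q(y)] hold coincide.  This is an equivalence relation between pairs of a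
    letter and an individual, so unary letters behave as fields of a record with
    values in a set that may be infinite, and two variables suffice to compare
    fields of two records.  The axioms of the theory have the form: every record
    [x] of a given kind has certain fields equal, or there is a record [y] of
    some kind sharing certain fields with [x].

    This language describes computations.  Values are binary trees, the leaf
    being the value that is forced at [w], and a node being witnessed by a record
    holding its two subtrees and itself; that node formation is injective and
    never gives a leaf is expressible.  A record of kind [f] holds an argument of
    [f], the result, and the intermediate results, each shared with a record of
    the subcomputation that produces it.  Five combinators and a while loop
    compute all partial recursive functions on trees ([compile_correct]).

    If the computation halts, then at any world that forces the theory and not
    [falsum] its run can be followed through the records ([runs_represents]), so
    a record cannot hold a wrong result.  The theory also demands a record saying
    that the search results in a leaf, whereas a search that halts results in a
    node.  If the computation diverges, the functions computed are made total by
    letting divergent loops result in a leaf ([value]); the records of all the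
    resulting true computations form a model over the natural numbers in which a
    field holds from the world numbered by its tree on, and [falsum] from the
    world 1 on. *)

(** * Computing with binary trees *)

Inductive tree : Type :=
| Leaf : tree
| Node : tree -> tree -> tree.

Fixpoint numeral (n : nat) : tree :=
  match n with 0 => Leaf | S n' => Node Leaf (numeral n') end.

Fixpoint tuple (xs : list nat) : tree :=
  match xs with [] => Leaf | x :: xs' => Node (numeral x) (tuple xs') end.

Inductive tree_fun : Type :=
| FLeaf : tree_fun
| FLeft : tree_fun
| FRight : tree_fun
| FNode : tree_fun -> tree_fun -> tree_fun
| FComp : tree_fun -> tree_fun -> tree_fun
| FWhile : tree_fun -> tree_fun -> tree_fun.

Inductive runs : tree_fun -> tree -> tree -> Prop :=
| runs_leaf s : runs FLeaf s Leaf
| runs_left s t : runs FLeft (Node s t) s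
| runs_right s t : runs FRight (Node s t) t
| runs_node f g s t u : runs f s t -> runs g s u -> runs (FNode f g) s (Node t u)
| runs_comp f g s t u : runs g s t -> runs f t u -> runs (FComp f g) s u
| runs_stop c d s : runs c s Leaf -> runs (FWhile c d) s s
| runs_step c d s t u s' r :
    runs c s (Node t u) -> runs d s s' -> runs (FWhile c d) s' r ->
    runs (FWhile c d) s r.

(** The loop whose test always succeeds stops at once. *)
Definition FId : tree_fun := FWhile FLeaf FLeaf.
Definition FSucc (f : tree_fun) : tree_fun := FNode FLeaf f.
Definition FNext : tree_fun := FNode (FSucc FLeft) FRight.

(** Projection of a tuple to its [i]-th entry. *)
Fixpoint FProj (i : nat) : tree_fun :=
  match i with 0 => FLeft | S i' => FComp (FProj i') FRight end.

(** Primitive recursion as a loop on tuples of the form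
    [k :: i :: y :: xs], where [k] steps remain, [i] steps are done and [y] is
    the value reached; [i :: y :: xs] is what the step function expects. *)
Definition FLoop (g : tree_fun) : tree_fun :=
  FWhile FLeft
    (FNode (FComp FRight FLeft)
       (FNode (FSucc (FComp FLeft FRight))
          (FNode (FComp g FRight) (FComp FRight (FComp FRight FRight))))).

Fixpoint compile (p : program) : tree_fun :=
  match p with
  | Zero => FLeaf
  | Succ => FSucc FLeft
  | Proj i => FProj i
  | Comp f gs =>
      FComp (compile f) (fold_right (fun g h => FNode (compile g) h) FLeaf gs)
  | PrimRec f g =>
      FComp (FComp FLeft (FComp FRight FRight))
        (FComp (FLoop (compile g))
           (FNode FLeft (FNode FLeaf (FNode (FComp (compile f) FRight) FRight))))
  | Mu f => FComp FLeft (FComp (FWhile (compile f) FNext) (FNode FLeaf FId))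
  end.

Lemma program_nested_ind (P : program -> Prop) :
  P Zero -> P Succ -> (forall i, P (Proj i)) ->
  (forall f gs, P f -> Forall P gs -> P (Comp f gs)) ->
  (forall f g, P f -> P g -> P (PrimRec f g)) ->
  (forall f, P f -> P (Mu f)) ->
  forall p, P p.
Proof.
  intros HZ HS HP HC HR HM. fix IH 1. intros [| |i|f gs|f g|f].
  - exact HZ.
  - exact HS.
  - apply HP.
  - apply HC; [apply IH|]. induction gs; constructor; [apply IH|assumption].
  - apply HR; apply IH.
  - apply HM; apply IH.
Qed.

Lemma runs_id s : runs FId s s.
Proof. apply runs_stop, runs_leaf. Qed.

Lemma runs_next x s : runs FNext (Node (numeral x) s) (Node (numeral (S x)) s).
Proof. repeat constructor. Qed.

(** Minimization: the loop stops at the first counter where [c] gives zero. *)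
Lemma runs_search c s n :
  (forall m, m < n -> exists k, runs c (Node (numeral m) s) (numeral (S k))) ->
  runs c (Node (numeral n) s) Leaf ->
  runs (FWhile c FNext) (Node Leaf s) (Node (numeral n) s).
Proof.
  intros Hpos Hzero.
  enough (H : forall j, j <= n ->
    runs (FWhile c FNext) (Node (numeral (n - j)) s) (Node (numeral n) s)).
  { specialize (H n (le_n n)). now rewrite Nat.sub_diag in H. }
  induction j as [|j IH]; intros Hj.
  - rewrite Nat.sub_0_r. now apply runs_stop.
  - destruct (Hpos (n - S j)) as [k Hk]; [lia|].
    eapply runs_step; [exact Hk|apply runs_next|].
    replace (S (n - S j)) with (n - j) by lia. apply IH; lia.
Qed.

Definition loop_state (k i y : nat) (xs : list nat) : tree :=
  Node (numeral k) (tuple (i :: y :: xs)).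

(** The loop counts up while the recursion unfolds downwards, so the statement is
    about the continuation of the loop: a run from the [n]-th state extends to a
    run from the initial state, whatever the number [k] of steps left after it. *)
Lemma runs_loop f g :
  (forall xs y, eval g xs y -> runs (compile g) (tuple xs) (numeral y)) ->
  forall xs n y, eval (PrimRec f g) (n :: xs) y ->
  exists y0, eval f xs y0 /\
    forall k r, runs (FLoop (compile g)) (loop_state k n y xs) r ->
    runs (FLoop (compile g)) (loop_state (n + k) 0 y0 xs) r.
Proof.
  intros Hg xs; induction n as [|n IH]; intros y H; inversion H; subst.
  - eauto.
  - match goal with H1 : eval (PrimRec f g) (n :: xs) _ |- _ =>
      destruct (IH _ H1) as (z & Hz & Hk) end.
    exists z; split; [assumption|]. intros k r Hr.
    replace (S n + k) with (n + S k) by lia. apply Hk.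
    eapply runs_step; [apply runs_left| |exact Hr].
    repeat econstructor. now apply Hg.
Qed.

Lemma runs_primrec f g n xs y :
  (forall xs y, eval f xs y -> runs (compile f) (tuple xs) (numeral y)) ->
  (forall xs y, eval g xs y -> runs (compile g) (tuple xs) (numeral y)) ->
  eval (PrimRec f g) (n :: xs) y ->
  runs (compile (PrimRec f g)) (tuple (n :: xs)) (numeral y).
Proof.
  intros Hf Hg H. destruct (runs_loop f g Hg _ _ _ H) as (y0 & Hy0 & Hk).
  specialize (Hk 0). rewrite Nat.add_0_r in Hk.
  apply runs_comp with (loop_state 0 n y xs).
  - apply runs_comp with (loop_state n 0 y0 xs).
    + apply runs_node; [apply runs_left|]. apply runs_node; [apply runs_leaf|].
      apply runs_node; [|apply runs_right].
      eapply runs_comp; [apply runs_right|]. now apply Hf.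
    + apply Hk. apply runs_stop, runs_left.
  - repeat econstructor.
Qed.

Lemma compile_correct p : forall xs y,
  eval p xs y -> runs (compile p) (tuple xs) (numeral y).
Proof.
  induction p as [| |i|f gs IHf IHgs|f g IHf IHg|f IHf] using program_nested_ind;
    intros xs y H; inversion H; subst; cbn [compile].
  - constructor.
  - repeat constructor.
  - match goal with H0 : nth_error _ _ = _ |- _ => revert H0 end. clear H.
    revert xs; induction i as [|i IH]; intros [|x xs] Hx; cbn in Hx; try discriminate.
    + injection Hx as ->. constructor.
    + eapply runs_comp; [constructor|]. now apply IH.
  - match goal with H0 : Forall2 _ gs ?l, H1 : eval f ?l y |- _ =>
      apply runs_comp with (tuple l); [|now apply IHf]; clear H H1;
      induction H0; inversion IHgs; subst; cbn; constructor; auto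
    end.
  - now apply runs_primrec with (y := y).
  - now apply runs_primrec with (y := y).
  - eapply runs_comp; [eapply runs_comp|].
    + constructor; [constructor|apply runs_id].
    + apply runs_search with (n := y).
      * intros m Hm.
        match goal with H0 : forall m, _ -> exists _, _ |- _ =>
          destruct (H0 m Hm) as [k Hk] end.
        exists k. now apply (IHf (m :: xs)).
      * now apply (IHf (y :: xs) 0).
    + constructor.
Qed.

(** ** Total values *)

Inductive loops (c d : tree -> tree) : tree -> tree -> Prop :=
| loops_stop s : c s = Leaf -> loops c d s s
| loops_step s r : c s <> Leaf -> loops c d (d s) r -> loops c d s r.

Lemma loops_det c d s r r' : loops c d s r -> loops c d s r' -> r = r'.
Proof.
  intros H; revert r'; induction H as [s Hs|s r Hs H IH]; intros r' H';
    inversion H'; subst; try contradiction; auto.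
Qed.

(** Sending divergent loops to a constant keeps the recursion equations of the
    loop ([loop_value_stop], [loop_value_step]), because the loop is
    tail-recursive: a state and its successor diverge together. *)
Definition loop_value (c d : tree -> tree) (s : tree) : tree :=
  epsilon (inhabits Leaf)
    (fun r => loops c d s r \/ r = Leaf /\ ~ exists r', loops c d s r').

Lemma loop_value_spec c d s :
  loops c d s (loop_value c d s) \/
  loop_value c d s = Leaf /\ ~ exists r', loops c d s r'.
Proof.
  apply (epsilon_spec (inhabits Leaf)
    (fun r => loops c d s r \/ r = Leaf /\ ~ exists r', loops c d s r')).
  destruct (classic (exists r', loops c d s r')) as [[r H]|H]; eauto.
Qed.

Lemma loop_value_stop c d s : c s = Leaf -> loop_value c d s = s.
Proof.
  intros H. apply (loops_stop c d) in H.
  destruct (loop_value_spec c d s) as [H'|[_ H']].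
  - eapply loops_det; eassumption.
  - destruct H'; eauto.
Qed.

Lemma loop_value_step c d s :
  c s <> Leaf -> loop_value c d s = loop_value c d (d s).
Proof.
  intros H. destruct (loop_value_spec c d (d s)) as [H1|[-> H1]];
    destruct (loop_value_spec c d s) as [H2|[H2 H3]].
  - eapply loops_det; [exact H2|]. now apply loops_step.
  - destruct H3. eexists. apply loops_step; eassumption.
  - destruct H1. inversion H2 as [|s' r Hs Hr]; [congruence|]. eauto.
  - assumption.
Qed.

Definition left_of (t : tree) : tree := match t with Leaf => Leaf | Node s _ => s end.
Definition right_of (t : tree) : tree := match t with Leaf => Leaf | Node _ s => s end.

Fixpoint value (f : tree_fun) (s : tree) : tree :=
  match f with
  | FLeaf => Leaf
  | FLeft => left_of s
  | FRight => right_of s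
  | FNode g h => Node (value g s) (value h s)
  | FComp g h => value g (value h s)
  | FWhile c d => loop_value (value c) (value d) s
  end.

Lemma runs_value f s t : runs f s t -> value f s = t.
Proof.
  induction 1; cbn; try congruence.
  - now apply loop_value_stop.
  - rewrite loop_value_step by congruence. cbn in *. congruence.
Qed.

(** * The formulas *)

(** A record of kind [Some f] has the argument of [f] in field 0, the result in
    field 1 and intermediate results in fields 2 and 3.  A record of kind [None]
    has a node in field 2 and its two subtrees in fields 0 and 1. *)
Inductive letter : Type :=
| Field : nat -> letter
| Kind : option tree_fun -> letter
| Falsum : letter.

Fixpoint fun_index (f : tree_fun) : nat :=
  match f with
  | FLeaf => to_nat (0, 0)
  | FLeft => to_nat (1, 0)
  | FRight => to_nat (2, 0)
  | FNode g h => to_nat (3, to_nat (fun_index g, fun_index h))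
  | FComp g h => to_nat (4, to_nat (fun_index g, fun_index h))
  | FWhile g h => to_nat (5, to_nat (fun_index g, fun_index h))
  end.

Definition index (l : letter) : nat :=
  match l with
  | Field i => to_nat (0, i)
  | Kind None => to_nat (1, 0)
  | Kind (Some f) => to_nat (2, fun_index f)
  | Falsum => to_nat (3, 0)
  end.

Lemma fun_index_inj f g : fun_index f = fun_index g -> f = g.
Proof.
  revert g; induction f; intros []; cbn [fun_index]; intros H;
    apply to_nat_inj in H; try discriminate; try reflexivity;
    apply (f_equal snd) in H; cbn [snd] in H; apply to_nat_inj in H;
    injection H; intros; f_equal; auto.
Qed.

Lemma index_inj l l' : index l = index l' -> l = l'.
Proof.
  destruct l as [i|[f|]|], l' as [i'|[f'|]|]; cbn [index]; intros H;
    apply to_nat_inj in H; try discriminate; try reflexivity;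
    apply (f_equal snd) in H; cbn [snd] in H.
  - now rewrite H.
  - now rewrite (fun_index_inj f f' H).
Qed.

Definition atom (l : letter) (x : nat) : formula := Atom (index l) [x].
Definition falsum : formula := All 0 (atom Falsum 0).
Definition neg (A : formula) : formula := Imp A falsum.
Definition same (l : letter) (x : nat) (l' : letter) (y : nat) : formula :=
  And (Imp (atom l x) (atom l' y)) (Imp (atom l' y) (atom l x)).

(** A pair [(i, j)] of [ps] identifies field [i] of the record called with
    field [j] of the caller.  The atom is put at the end of the conjunction
    because there is no positive formula for an empty one. *)
Definition call (k : option tree_fun) (ps : list (nat * nat)) : formula :=
  Ex 1 (fold_right (fun p A => And (same (Field (fst p)) 1 (Field (snd p)) 0) A)
          (atom (Kind k) 1) ps).

(** In the first disjunct for [FLeft] and [FRight] the argument is a leaf, about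
    whose subtrees nothing has to be said. *)
Definition body (f : tree_fun) : formula :=
  match f with
  | FLeaf => atom (Field 1) 0
  | FLeft => Or (atom (Field 0) 0) (call None [(0, 1); (1, 2); (2, 0)])
  | FRight => Or (atom (Field 0) 0) (call None [(0, 2); (1, 1); (2, 0)])
  | FNode g h =>
      And (call (Some g) [(0, 0); (1, 2)])
        (And (call (Some h) [(0, 0); (1, 3)])
           (call None [(0, 2); (1, 3); (2, 1)]))
  | FComp g h =>
      And (call (Some h) [(0, 0); (1, 2)]) (call (Some g) [(0, 2); (1, 1)])
  | FWhile c d =>
      And (call (Some c) [(0, 0); (1, 2)])
        (And (Or (neg (atom (Field 2) 0)) (same (Field 1) 0 (Field 0) 0))
           (Or (atom (Field 2) 0)
              (And (call (Some d) [(0, 0); (1, 3)])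
                 (call (Some f) [(0, 3); (1, 1)]))))
  end.

Definition rule (f : tree_fun) : formula :=
  All 0 (Or (neg (atom (Kind (Some f)) 0)) (body f)).

Fixpoint rules (f : tree_fun) : formula :=
  match f with
  | FNode g h | FComp g h | FWhile g h => And (rule f) (And (rules g) (rules h))
  | _ => rule f
  end.

Definition node_nonleaf : formula :=
  All 0 (Or (neg (atom (Kind None) 0)) (neg (atom (Field 2) 0))).

Definition node_injective : formula :=
  All 0 (All 1
    (Or (neg (And (atom (Kind None) 0)
                (And (atom (Kind None) 1) (same (Field 2) 0 (Field 2) 1))))
       (And (same (Field 0) 0 (Field 0) 1) (same (Field 1) 0 (Field 1) 1)))).

(** Both variables are free for reuse: once [y] is fixed as the record of the node,
    [x] is requantified to hold each subtree in its field 0. *)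
Definition denotes_node (A B : formula) : formula :=
  Ex 1 (And (atom (Kind None) 1)
    (And (same (Field 2) 1 (Field 0) 0)
       (And (Ex 0 (And (same (Field 0) 1 (Field 0) 0) A))
          (Ex 0 (And (same (Field 1) 1 (Field 0) 0) B))))).

Fixpoint denotes (t : tree) : formula :=
  match t with
  | Leaf => atom (Field 0) 0
  | Node s u => denotes_node (denotes s) (denotes u)
  end.

(** Field 1 is the result; a leaf there stands for a loop that never stops. *)
Definition diverges (f : tree_fun) (s : tree) : formula :=
  Ex 0 (And (atom (Kind (Some f)) 0) (And (atom (Field 1) 0) (denotes s))).

Definition halting (f : tree_fun) (s : tree) : formula :=
  Imp (And (And node_nonleaf node_injective) (And (rules f) (diverges f s))) falsum.

(** * The positive fragment with two variables *)

Definition in_fragment (A : formula) : Prop := positive A /\ two_var_one_binary A.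

Lemma fragment_atom l x : x < 2 -> in_fragment (atom l x).
Proof. intros H; split; cbn; auto. Qed.

Lemma fragment_and A B : in_fragment A -> in_fragment B -> in_fragment (And A B).
Proof. unfold in_fragment; cbn; tauto. Qed.

Lemma fragment_or A B : in_fragment A -> in_fragment B -> in_fragment (Or A B).
Proof. unfold in_fragment; cbn; tauto. Qed.

Lemma fragment_imp A B : in_fragment A -> in_fragment B -> in_fragment (Imp A B).
Proof. unfold in_fragment; cbn; tauto. Qed.

Lemma fragment_all x A : x < 2 -> in_fragment A -> in_fragment (All x A).
Proof. unfold in_fragment; cbn; tauto. Qed.

Lemma fragment_ex x A : x < 2 -> in_fragment A -> in_fragment (Ex x A).
Proof. unfold in_fragment; cbn; tauto. Qed.

#[local] Hint Resolve fragment_atom fragment_and fragment_or fragment_imp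
  fragment_all fragment_ex Nat.lt_0_2 Nat.lt_1_2 : fragment.

Lemma fragment_neg A : in_fragment A -> in_fragment (neg A).
Proof. unfold neg, falsum; auto with fragment. Qed.

Lemma fragment_same l x l' y : x < 2 -> y < 2 -> in_fragment (same l x l' y).
Proof. unfold same; auto with fragment. Qed.

#[local] Hint Resolve fragment_neg fragment_same : fragment.

Lemma fragment_call k ps : in_fragment (call k ps).
Proof. apply fragment_ex; auto with fragment. induction ps; cbn; auto with fragment. Qed.

#[local] Hint Resolve fragment_call : fragment.

Lemma fragment_rules f : in_fragment (rules f).
Proof.
  assert (H : forall g, in_fragment (rule g)).
  { intros []; unfold rule; cbn [body]; auto 12 with fragment. }
  induction f; cbn [rules]; auto with fragment.
Qed.

Lemma fragment_denotes t : in_fragment (denotes t).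
Proof. induction t; cbn [denotes]; unfold denotes_node; auto 12 with fragment. Qed.

Lemma fragment_halting f s : in_fragment (halting f s).
Proof.
  unfold halting, node_nonleaf, node_injective, diverges, falsum.
  auto 14 using fragment_rules, fragment_denotes with fragment.
Qed.

(** * Halting computations give valid formulas *)

Section Forcing.
Context {F : frame} {FD : augmented_frame F} (M : model FD) (w : F).

Definition holds (v : F) (l : letter) (d : carrier FD) : Prop :=
  interp M v (index l) [d].

(** The value of [l] at [d] is an up-set of worlds above [w]; this is equality of
    such values. *)
Definition equal (l : letter) (d : carrier FD) (l' : letter) (e : carrier FD) : Prop :=
  forall v, acc w v -> (holds v l d <-> holds v l' e).

Lemma force_same a l x l' y :
  force M w a (same l x l' y) <-> equal l (a x) l' (a y).
Proof. unfold equal, holds; cbn; firstorder. Qed.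

Lemma force_call a k ps :
  force M w a (call k ps) <->
  exists d, dom FD w d /\ holds w (Kind k) d /\
    forall i j, In (i, j) ps -> equal (Field i) d (Field j) (a 0).
Proof.
  unfold call; cbn [force].
  split; intros (d & Hd & H); exists d; (split; [exact Hd|]).
  - induction ps as [|[i j] ps IH]; cbn [fold_right] in H.
    + split; [exact H|]. intros i j [].
    + destruct H as [H1 H2]. apply force_same in H1. destruct (IH H2) as [H3 H4].
      split; [exact H3|]. intros i' j' [E|E]; [|auto].
      injection E as <- <-. exact H1.
  - destruct H as [H1 H2]. induction ps as [|[i j] ps IH]; cbn [fold_right].
    + exact H1.
    + split; [|apply IH; intros; apply H2; now right].
      apply force_same, H2. now left.
Qed.

Lemma equal_sym l d l' e : equal l d l' e -> equal l' e l d.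
Proof. firstorder. Qed.

Lemma equal_trans l1 d1 l2 d2 l3 d3 :
  equal l1 d1 l2 d2 -> equal l2 d2 l3 d3 -> equal l1 d1 l3 d3.
Proof. intros H1 H2 v Hv. rewrite (H1 v Hv). auto. Qed.

Lemma acc_refl (v : F) : acc v v.
Proof. destruct (acc_order F) as [refl _ _]. apply refl. Qed.

Lemma equal_holds l d l' e : equal l d l' e -> holds w l d -> holds w l' e.
Proof. intros H. apply H, acc_refl. Qed.

(** The value of [l] at [d] codes the tree; a node is recognized by the records of
    the model itself. *)
Fixpoint represents (t : tree) (l : letter) (d : carrier FD) : Prop :=
  match t with
  | Leaf => holds w l d
  | Node s u =>
      exists e, dom FD w e /\ holds w (Kind None) e /\ equal (Field 2) e l d /\
        represents s (Field 0) e /\ represents u (Field 1) e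
  end.

Lemma represents_equal t l d l' e :
  equal l d l' e -> represents t l d -> represents t l' e.
Proof.
  destruct t; cbn; [apply equal_holds|].
  intros H (x & Hx & K & E & R). exists x. repeat split; try tauto;
  apply (equal_trans _ _ _ _ _ _ E H); assumption.
Qed.

Lemma force_denotes t : forall a,
  force M w a (denotes t) -> represents t (Field 0) (a 0).
Proof.
  induction t as [|s IHs u IHu]; intros a; cbn [denotes force represents].
  - exact (fun H => H).
  - intros (e & He & K & E & (x & Hx & Ex & Rx) & (y & Hy & Ey & Ry)).
    apply force_same in E, Ex, Ey. exists e. repeat split; auto; try apply E; auto.
    + apply (represents_equal _ _ _ _ _ (equal_sym _ _ _ _ Ex)), (IHs _ Rx).
    + apply (represents_equal _ _ _ _ _ (equal_sym _ _ _ _ Ey)), (IHu _ Ry).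
Qed.

Context (a : nat -> carrier FD) (consistent : ~ force M w a falsum).

Lemma neg_or b A B :
  force M w b (neg A) \/ force M w b B -> force M w b A -> force M w b B.
Proof.
  intros [H|H] HA; [|exact H]. exfalso. exact (consistent (H w (acc_refl w) HA)).
Qed.

Lemma force_instance b x A d :
  force M w b (All x A) -> dom FD w d -> force M w (update b x d) A.
Proof. intros H Hd. exact (H w (acc_refl w) d Hd). Qed.

Lemma force_rule b x A B d :
  force M w b (All x (Or (neg A) B)) -> dom FD w d ->
  force M w (update b x d) A -> force M w (update b x d) B.
Proof. intros H Hd. apply neg_or. exact (force_instance _ _ _ _ H Hd). Qed.

Context (nonleaf : force M w a node_nonleaf) (inj : force M w a node_injective).

Lemma represents_node_nonleaf s u l d : represents (Node s u) l d -> ~ holds w l d.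
Proof.
  intros (e & He & K & E & _) H.
  apply consistent.
  refine (force_rule _ _ _ _ _ nonleaf He K w (acc_refl w) _).
  exact (equal_holds _ _ _ _ (equal_sym _ _ _ _ E) H).
Qed.

(** Injectivity transfers the subtrees from the record witnessing that field 2 of
    [e] codes a node to [e] itself. *)
Lemma represents_node_inv s u e :
  dom FD w e -> holds w (Kind None) e -> represents (Node s u) (Field 2) e ->
  represents s (Field 0) e /\ represents u (Field 1) e.
Proof.
  intros He K (e' & He' & K' & E & Rs & Ru).
  destruct (force_rule _ _ _ _ _ (force_instance _ _ _ _ inj He') He) as [E0 E1].
  - split; [exact K'|]. split; [exact K|]. apply force_same. exact E.
  - apply force_same in E0, E1.
    split; eapply represents_equal; eassumption.
Qed.

Lemma call_result k ps b :
  force M w b (call k ps) ->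
  exists e, dom FD w e /\ holds w (Kind k) e /\
    (forall i j t, In (i, j) ps ->
       represents t (Field i) e <-> represents t (Field j) (b 0)).
Proof.
  intros H. apply force_call in H. destruct H as (e & He & K & H).
  exists e. do 2 (split; [assumption|]). intros i j t Hin. specialize (H _ _ Hin).
  split; apply represents_equal; [|apply equal_sym]; exact H.
Qed.

(** Each rule provides the records of the subcomputations, to which the induction
    hypothesis applies.  The test of a loop decides at [w] between the two
    alternatives: a leaf is forced, so its negation is not and the result must be
    the argument; a node is not forced, so the records of the next round exist. *)
Lemma runs_represents f s t : runs f s t -> force M w a (rules f) ->
  forall d, dom FD w d -> holds w (Kind (Some f)) d ->
  represents s (Field 0) d -> represents t (Field 1) d.
Proof.
  assert (R : forall g, force M w a (rule g) -> forall d, dom FD w d ->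
    holds w (Kind (Some g)) d -> force M w (update a 0 d) (body g)).
  { intros g Hg d Hd K. exact (force_rule _ _ _ _ _ Hg Hd K). }
  induction 1 as [s|s t|s t|f g s t u _ IHf _ IHg|f g s t u _ IHg _ IHf
                 |c c' s _ IHc|c c' s t u s' r _ IHc _ IHd _ IHw];
    intros HR d Hd K A.
  - exact (R _ HR d Hd K).
  - pose proof (R _ HR d Hd K) as B; cbn [body force] in B; destruct B as [H|H].
    + now destruct (represents_node_nonleaf _ _ _ _ A).
    + destruct (call_result _ _ _ H) as (e & He & Ke & E).
      apply (E 0 1); [cbn; tauto|].
      apply (E 2 0 (Node s t)) in A; [|cbn; tauto].
      now apply (represents_node_inv _ _ _ He Ke A).
  - pose proof (R _ HR d Hd K) as B; cbn [body force] in B; destruct B as [H|H].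
    + now destruct (represents_node_nonleaf _ _ _ _ A).
    + destruct (call_result _ _ _ H) as (e & He & Ke & E).
      apply (E 1 1); [cbn; tauto|].
      apply (E 2 0 (Node s t)) in A; [|cbn; tauto].
      now apply (represents_node_inv _ _ _ He Ke A).
  - cbn [rules force] in HR; destruct HR as (Hr & Hf & Hg).
    pose proof (R _ Hr d Hd K) as B; cbn [body force] in B; destruct B as (Cf & Cg & Cn).
    destruct (call_result _ _ _ Cf) as (ef & Hef & Kf & Ef).
    destruct (call_result _ _ _ Cg) as (eg & Heg & Kg & Eg).
    destruct (call_result _ _ _ Cn) as (en & Hen & Kn & En).
    apply (En 2 1); [cbn; tauto|].
    exists en. do 2 (split; [assumption|]). split; [firstorder|].
    split.
    + apply (En 0 2); [cbn; tauto|]. apply (Ef 1 2); [cbn; tauto|].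
      apply IHf; auto. apply (Ef 0 0); [cbn; tauto|exact A].
    + apply (En 1 3); [cbn; tauto|]. apply (Eg 1 3); [cbn; tauto|].
      apply IHg; auto. apply (Eg 0 0); [cbn; tauto|exact A].
  - cbn [rules force] in HR; destruct HR as (Hr & Hf & Hg).
    pose proof (R _ Hr d Hd K) as B; cbn [body force] in B; destruct B as (Cg & Cf).
    destruct (call_result _ _ _ Cf) as (ef & Hef & Kf & Ef).
    destruct (call_result _ _ _ Cg) as (eg & Heg & Kg & Eg).
    apply (Ef 1 1); [cbn; tauto|]. apply IHf; auto.
    apply (Ef 0 2); [cbn; tauto|]. apply (Eg 1 2); [cbn; tauto|].
    apply IHg; auto. apply (Eg 0 0); [cbn; tauto|exact A].
  - cbn [rules force] in HR; destruct HR as (Hr & Hc & Hd').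
    pose proof (R _ Hr d Hd K) as B; cbn [body force] in B; destruct B as (Cc & Cs & _).
    destruct (call_result _ _ _ Cc) as (ec & Hec & Kc & Ec).
    assert (H2 : represents Leaf (Field 2) d).
    { apply (Ec 1 2); [cbn; tauto|]. apply IHc; auto.
      apply (Ec 0 0); [cbn; tauto|exact A]. }
    apply (neg_or _ _ _ Cs), force_same in H2.
    exact (represents_equal _ _ _ _ _ (equal_sym _ _ _ _ H2) A).
  - pose proof HR as HR'; cbn [rules force] in HR'; destruct HR' as (Hr & Hc & Hd').
    pose proof (R _ Hr d Hd K) as B; cbn [body force] in B; destruct B as (Cc & _ & Cs).
    destruct (call_result _ _ _ Cc) as (ec & Hec & Kc & Ec).
    destruct Cs as [H2|[Cd Cw]].
    + exfalso. refine (represents_node_nonleaf t u _ _ _ H2).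
      apply (Ec 1 2); [cbn; tauto|]. apply IHc; auto.
      apply (Ec 0 0); [cbn; tauto|exact A].
    + destruct (call_result _ _ _ Cd) as (ed & Hed & Kd & Ed).
      destruct (call_result _ _ _ Cw) as (ew & Hew & Kw & Ew).
      apply (Ew 1 1); [cbn; tauto|]. apply IHw; auto.
      apply (Ew 0 3); [cbn; tauto|]. apply (Ed 1 3); [cbn; tauto|].
      apply IHd; auto. apply (Ed 0 0); [cbn; tauto|exact A].
Qed.

End Forcing.

(** The theory says that the result of [f] on [s] is a leaf, but the run shows
    that it is a node. *)
Theorem halting_valid f s t u : runs f s (Node t u) -> QInt (halting f s).
Proof.
  intros Hrun F FD M w0 a _ w Hw [[Hleaf Hinj] [Hrules Hdiv]].
  destruct (classic (force M w a falsum)) as [Hf|Hf]; [exact Hf|exfalso].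
  destruct Hdiv as (d & Hd & K & Hz & Hs).
  refine (represents_node_nonleaf M w a Hf Hleaf t u _ _ _ Hz).
  apply (runs_represents M w a Hf Hleaf Hinj f s); auto.
  exact (force_denotes M w s _ Hs).
Qed.

(** * Divergent computations give refuted formulas *)

Fixpoint tree_index (t : tree) : nat :=
  match t with
  | Leaf => 0
  | Node s u => S (to_nat (tree_index s, tree_index u))
  end.

Lemma tree_index_inj s t : tree_index s = tree_index t -> s = t.
Proof.
  revert t; induction s as [|s IHs u IHu]; intros [|s' u']; cbn [tree_index];
    intros H; try discriminate; [reflexivity|].
  apply Nat.succ_inj, to_nat_inj in H. injection H; intros; f_equal; auto.
Qed.

(** Individuals are numbers read as trees, and a tree is read in turn as an
    infinite list of fields, of which all but finitely many are leaves. *)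
Definition record (d : nat) : tree :=
  epsilon (inhabits Leaf) (fun t => tree_index t = d).

Lemma record_index t : record (tree_index t) = t.
Proof.
  apply tree_index_inj. unfold record.
  apply (epsilon_spec (inhabits Leaf) (fun s => tree_index s = tree_index t)).
  now exists t.
Qed.

Fixpoint component (i : nat) (t : tree) : tree :=
  match i with 0 => left_of t | S i' => component i' (right_of t) end.

Definition field (i d : nat) : tree := component i (record d).
#[local] Arguments field : simpl never.

Lemma record_exists (ts : list tree) : exists d, forall i, field i d = nth i ts Leaf.
Proof.
  exists (tree_index (fold_right Node Leaf ts)). intros i. unfold field.
  rewrite record_index. revert i. induction ts as [|t ts IH]; intros i.
  - cbn [fold_right]. induction i as [|[|i] IHi]; cbn in *; auto.
  - destruct i as [|i]; [reflexivity|]. exact (IH i).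
Qed.

(** The records of true computations, intermediate results included. *)
Definition correct (k : option tree_fun) (d : nat) : Prop :=
  match k with
  | None => field 2 d = Node (field 0 d) (field 1 d)
  | Some f => field 1 d = value f (field 0 d) /\
      match f with
      | FLeaf => True
      | FLeft => field 0 d = Leaf \/ field 0 d = Node (field 1 d) (field 2 d)
      | FRight => field 0 d = Leaf \/ field 0 d = Node (field 2 d) (field 1 d)
      | FNode g h => field 2 d = value g (field 0 d) /\ field 3 d = value h (field 0 d)
      | FComp g h => field 2 d = value h (field 0 d)
      | FWhile c c' => field 2 d = value c (field 0 d) /\ field 3 d = value c' (field 0 d)
      end
  end.

(** The threshold [tree_index] makes the values of two fields the same up-set of
    worlds exactly when they are the same tree, and the leaf, of index 0, the one
    tree whose value holds at world 0.  Letters for kinds and [falsum] hold at all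
    later worlds, so that only world 0 matters. *)
Definition truth (v : nat) (l : letter) (d : nat) : Prop :=
  match l with
  | Field i => tree_index (field i d) <= v
  | Kind k => v = 0 -> correct k d
  | Falsum => v <> 0
  end.

Definition standard_interp (v i : nat) (ds : list nat) : Prop :=
  exists l d, i = index l /\ ds = [d] /\ truth v l d.

Definition standard_model : model (constant_domain nat_frame nat 0).
Proof.
  refine {| interp := standard_interp : nat_frame -> nat ->
              list (carrier (constant_domain nat_frame nat 0)) -> Prop |}.
  - intros w i ds _. apply Forall_forall. now intros.
  - intros u w Huw i ds (l & d & Hi & Hd & H). exists l, d. do 2 (split; [assumption|]).
    cbn in Huw. destruct l; cbn in *; try lia. intros ->. apply H. lia.
Defined.

Lemma standard_holds v l d :
  holds standard_model v l d <-> truth v l d.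
Proof.
  split.
  - intros (l' & d' & Hi & Hd & H). apply index_inj in Hi. injection Hd as ->. now subst.
  - intros H. now exists l, d.
Qed.

Lemma standard_equal i d j e :
  equal standard_model 0 (Field i) d (Field j) e <-> field i d = field j e.
Proof.
  unfold equal. setoid_rewrite standard_holds. cbn. split.
  - intros H. apply tree_index_inj, Nat.le_antisymm; apply H; lia.
  - intros -> v _. reflexivity.
Qed.

Lemma standard_falsum (v : nat) a : force standard_model v a falsum <-> v <> 0.
Proof.
  split.
  - intros H. specialize (H v (le_n v) 0 I). now apply (standard_holds v Falsum) in H.
  - intros Hv v' Hv' d _. apply (standard_holds v' Falsum). cbn in *. lia.
Qed.

(** Negation at world 0 is classical because [falsum] holds at all later worlds. *)
Lemma standard_neg a A :
  ~ force standard_model 0 a A -> force standard_model 0 a (neg A).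
Proof.
  intros H v _ Hv. apply standard_falsum. intros ->. exact (H Hv).
Qed.

(** At later worlds the first disjunct is forced along with [falsum]; this is why
    the axioms are disjunctions, and not implications, under the quantifier. *)
Lemma standard_all x a A B :
  (forall d, force standard_model 0 (update a x d) A ->
     force standard_model 0 (update a x d) B) ->
  force standard_model 0 a (All x (Or (neg A) B)).
Proof.
  intros H v _ d _. destruct v as [|v].
  - destruct (classic (force standard_model 0 (update a x d) A)) as [HA|HA].
    + right. now apply H.
    + left. now apply standard_neg.
  - left. intros v' Hv' _. apply standard_falsum. cbn in Hv'. lia.
Qed.

Lemma standard_call a k ps :
  force standard_model 0 a (call k ps) <->
  exists d, correct k d /\ forall i j, In (i, j) ps -> field i d = field j (a 0).
Proof.
  rewrite force_call. split.
  - intros (d & _ & K & H). exists d. apply standard_holds in K. split.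
    + now apply K.
    + intros i j Hin. now apply standard_equal, H.
  - intros (d & K & H). exists d. split; [exact I|]. split.
    + now apply standard_holds.
    + intros i j Hin. now apply standard_equal, H.
Qed.

Lemma correct_exists f s :
  exists d, correct (Some f) d /\ field 0 d = s /\ field 1 d = value f s.
Proof.
  destruct f as [| | |g h|g h|c c'];
    [destruct (record_exists [s; Leaf]) as [d Hd]
    |destruct (record_exists [s; left_of s; right_of s]) as [d Hd]
    |destruct (record_exists [s; right_of s; left_of s]) as [d Hd]
    |destruct (record_exists [s; value (FNode g h) s; value g s; value h s]) as [d Hd]
    |destruct (record_exists [s; value (FComp g h) s; value h s]) as [d Hd]
    |destruct (record_exists [s; value (FWhile c c') s; value c s; value c' s]) as [d Hd]];
    exists d; cbn [correct]; rewrite ?Hd; cbn [nth];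
    repeat (split; try reflexivity); destruct s; auto.
Qed.

Lemma node_exists s t :
  exists d, correct None d /\ field 0 d = s /\ field 1 d = t /\ field 2 d = Node s t.
Proof.
  destruct (record_exists [s; t; Node s t]) as [d Hd].
  exists d. cbn [correct]. now rewrite !Hd.
Qed.

Lemma standard_rule f a : force standard_model 0 a (rule f).
Proof.
  apply standard_all. intros d K. apply standard_holds in K. specialize (K eq_refl).
  cbn in K.
  assert (Hsub : forall g i j, field j d = value g (field i d) ->
    force standard_model 0 (update a 0 d) (call (Some g) [(0, i); (1, j)])).
  { intros g i j H. apply standard_call.
    destruct (correct_exists g (field i d)) as (e & Ke & E0 & E1).
    exists e. split; [exact Ke|]. change (update a 0 d 0) with d.
    intros i' j' [E|[E|[]]]; injection E as <- <-.
    - exact E0.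
    - congruence. }
  assert (Hnode : forall i j k, field k d = Node (field i d) (field j d) ->
    force standard_model 0 (update a 0 d) (call None [(0, i); (1, j); (2, k)])).
  { intros i j k H. apply standard_call.
    destruct (node_exists (field i d) (field j d)) as (e & Ke & E0 & E1 & E2).
    exists e. split; [exact Ke|].
    change (update a 0 d 0) with d.
    intros i' j' [E|[E|[E|[]]]]; injection E as <- <-; congruence. }
  assert (Hleaf : forall i, field i d = Leaf ->
    force standard_model 0 (update a 0 d) (atom (Field i) 0)).
  { intros i H. apply standard_holds. cbn. rewrite H. apply le_n. }
  destruct f as [| | |g h|g h|c c']; cbn [body force]; destruct K as [K1 K2];
    cbn [value] in K1.
  - now apply Hleaf.
  - destruct K2; auto.
  - destruct K2; auto.
  - destruct K2. repeat split; auto. apply Hnode. congruence.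
  - split; auto. apply Hsub. congruence.
  - destruct K2 as [K2 K3]. split; [auto|].
    destruct (field 2 d) as [|t u] eqn:E2.
    + split; [right|left; auto]. apply force_same, standard_equal.
      cbn. rewrite K1. now apply loop_value_stop.
    + split; [left|right].
      * apply standard_neg. intros H. apply standard_holds in H. cbn in H.
        rewrite E2 in H. cbn in H. lia.
      * split; [auto|]. apply Hsub. rewrite K1, K3. cbn [value].
        apply loop_value_step. congruence.
Qed.

Lemma standard_rules f a : force standard_model 0 a (rules f).
Proof. induction f; cbn [rules force]; auto using standard_rule. Qed.

Lemma standard_node_nonleaf a : force standard_model 0 a node_nonleaf.
Proof.
  apply standard_all. intros d K. apply standard_holds in K. specialize (K eq_refl).
  apply standard_neg. intros H. apply standard_holds in H. cbn in K, H.
  rewrite K in H. cbn in H. lia.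
Qed.

Lemma standard_node_injective a : force standard_model 0 a node_injective.
Proof.
  intros v _ d _. destruct v as [|v].
  - apply standard_all. intros e (Kd & Ke & E).
    apply standard_holds in Kd, Ke. specialize (Kd eq_refl). specialize (Ke eq_refl).
    apply force_same, standard_equal in E. cbn in Kd, Ke, E.
    rewrite Kd, Ke in E. injection E as E0 E1.
    split; apply force_same, standard_equal; assumption.
  - intros v' Hv' e _. left. intros v'' Hv'' _. apply standard_falsum. cbn in *. lia.
Qed.

Lemma standard_denotes t : forall a, field 0 (a 0) = t ->
  force standard_model 0 a (denotes t).
Proof.
  induction t as [|s IHs u IHu]; intros a H; cbn [denotes].
  - apply standard_holds. cbn. rewrite H. apply le_n.
  - destruct (node_exists s u) as (e & Ke & E0 & E1 & E2).
    assert (Harg : forall r, exists d, field 0 d = r).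
    { intros r. destruct (record_exists [r]) as [d Hd]. exists d. apply (Hd 0). }
    destruct (Harg s) as [x Hx], (Harg u) as [y Hy].
    exists e. split; [exact I|]. split; [now apply standard_holds|].
    split; [apply force_same, standard_equal; cbn; congruence|].
    split; [exists x|exists y]; (split; [exact I|]); split; auto;
      apply force_same, standard_equal; cbn; congruence.
Qed.

(** The record of [f] at the argument [s] holds a leaf as its result. *)
Theorem halting_refuted f s :
  value f s = Leaf -> ~ QSIL (constant_domain nat_frame nat 0) (halting f s).
Proof.
  intros Hv H.
  assert (H0 : force standard_model 0 (fun _ => 0) falsum).
  { apply (H standard_model 0 (fun _ => 0) (fun _ _ => I) 0 (le_n 0)).
    split; [split; [apply standard_node_nonleaf|apply standard_node_injective]|].
    split; [apply standard_rules|].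
    destruct (correct_exists f s) as (d & K & E0 & E1).
    exists d. split; [exact I|]. split; [now apply standard_holds|].
    split; [|now apply standard_denotes].
    apply standard_holds. cbn. rewrite E1, Hv. apply le_n. }
  now apply standard_falsum in H0.
Qed.

(** * The search for a zero *)

(** The counter of the search comes first in its state, while [p] takes the fixed
    argument first. *)
Definition search (p : program) : tree_fun :=
  FWhile (compile (Comp p [Proj 1; Proj 0])) FNext.

Lemma eval_swap p n m y : eval p [n; m] y -> eval (Comp p [Proj 1; Proj 0]) [m; n] y.
Proof.
  intros H. apply eval_Comp with [n; m]; [|exact H].
  repeat constructor.
Qed.

Lemma search_runs p f n m :
  (forall n m, eval p [n; m] (f n m)) -> f n m = 0 ->
  exists k, runs (search p) (tuple [0; n]) (tuple [k; n]).
Proof.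
  intros Hp Hm.
  assert (Hc : forall k, runs (compile (Comp p [Proj 1; Proj 0])) (tuple [k; n])
                           (numeral (f n k))).
  { intros k. now apply compile_correct, eval_swap. }
  destruct (dec_inh_nat_subset_has_unique_least_element (fun k => f n k = 0))
    as (k & [Hk Hleast] & _).
  - intros k. destruct (Nat.eq_dec (f n k) 0); auto.
  - now exists m.
  - exists k. apply runs_search.
    + intros j Hj. exists (pred (f n j)).
      rewrite Nat.succ_pred; [apply Hc|].
      intros E. apply Hleast in E. lia.
    + specialize (Hc k). now rewrite Hk in Hc.
Qed.

Lemma search_diverges p f n :
  (forall n m, eval p [n; m] (f n m)) -> (forall m, f n m <> 0) ->
  value (search p) (tuple [0; n]) = Leaf.
Proof.
  intros Hp Hf. cbn [search value].
  destruct (loop_value_spec (value (compile (Comp p [Proj 1; Proj 0]))) (value FNext)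
              (tuple [0; n])) as [H|[H _]]; [exfalso|exact H].
  assert (Hc : forall k, value (compile (Comp p [Proj 1; Proj 0])) (tuple [k; n])
                         <> Leaf).
  { intros k. rewrite (runs_value _ _ (numeral (f n k))).
    - specialize (Hf k). destruct (f n k); [congruence|discriminate].
    - now apply compile_correct, eval_swap. }
  assert (Hn : forall k, value FNext (tuple [k; n]) = tuple [S k; n]).
  { intros k. apply runs_value, runs_next. }
  revert H. generalize (loop_value (value (compile (Comp p [Proj 1; Proj 0])))
    (value FNext) (tuple [0; n])). intros r H.
  remember (tuple [0; n]) as s eqn:Es.
  assert (E : exists k, s = tuple [k; n]) by eauto. clear Es.
  induction H as [s Hs|s r Hs H IH]; destruct E as [k ->].
  - now apply (Hc k).
  - apply IH. exists (S k). apply Hn.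
Qed.

(** * Computability of the reduction *)

Lemma eval_constant c : exists p, forall xs, eval p xs c.
Proof.
  induction c as [|c [p Hp]].
  - exists Zero. constructor.
  - exists (Comp Succ [p]). intros xs. apply eval_Comp with [c]; [|constructor].
    repeat constructor. apply Hp.
Qed.

Lemma computable_constant c : computable (fun _ => c).
Proof. destruct (eval_constant c) as [p Hp]. exists p. auto. Qed.

Lemma computable_id : computable (fun n => n).
Proof. exists (Proj 0). now constructor. Qed.

Lemma computable_comp g f :
  computable g -> computable f -> computable (fun n => g (f n)).
Proof.
  intros [p Hp] [q Hq]. exists (Comp p [q]). intros n.
  apply eval_Comp with [f n]; auto.
Qed.

Lemma computable_comp2 h f g : computable2 h -> computable f -> computable g ->
  computable (fun n => h (f n) (g n)).
Proof.
  intros [r Hr] [p Hp] [q Hq]. exists (Comp r [p; q]). intros n.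
  apply eval_Comp with [f n; g n]; auto.
Qed.

Lemma computable_rec f h :
  (forall n, f (S n) = h (f n)) -> computable h -> computable f.
Proof.
  intros Hf [p Hp]. destruct (eval_constant (f 0)) as [q Hq].
  exists (PrimRec q (Comp p [Proj 1])). induction n as [|n IH].
  - now constructor.
  - apply eval_PrimRec_S with (f n); [exact IH|]. rewrite Hf.
    apply eval_Comp with [f n]; auto. repeat constructor.
Qed.

Lemma computable2_add : computable2 Nat.add.
Proof.
  exists (PrimRec (Proj 0) (Comp Succ [Proj 1])). intros n m.
  induction n as [|n IH].
  - now repeat constructor.
  - apply eval_PrimRec_S with (n + m); [exact IH|].
    apply eval_Comp with [n + m]; repeat constructor.
Qed.

Definition triangle (n : nat) : nat := nat_rec _ 0 (fun i m => S i + m) n.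

Lemma computable_triangle : computable triangle.
Proof.
  destruct computable2_add as [p Hp].
  exists (PrimRec Zero (Comp p [Comp Succ [Proj 0]; Proj 1])). induction n as [|n IH].
  - repeat constructor.
  - apply eval_PrimRec_S with (triangle n); [exact IH|].
    apply eval_Comp with [S n; triangle n]; [|apply Hp].
    repeat constructor. apply eval_Comp with [n]; repeat constructor.
Qed.

Lemma computable_pair f g :
  computable f -> computable g -> computable (fun n => to_nat (f n, g n)).
Proof.
  intros Hf Hg.
  apply (computable_comp2 Nat.add g (fun n => triangle (g n + f n)));
    [exact computable2_add|exact Hg|].
  apply (computable_comp triangle); [exact computable_triangle|].
  now apply computable_comp2; [exact computable2_add| |].
Qed.

(** Formula contexts that act computably on codes.  The reduction only inserts
    numerals into a fixed context, and the formula of a numeral iterates another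
    one, so that the codes of the fixed parts enter as constants. *)
Definition code_computable (K : formula -> formula) : Prop :=
  exists h, computable h /\ forall A, code (K A) = h (code A).

Lemma code_computable_hole : code_computable (fun A => A).
Proof. exists (fun n => n). split; [apply computable_id|reflexivity]. Qed.

Lemma code_computable_constant B : code_computable (fun _ => B).
Proof. exists (fun _ => code B). split; [apply computable_constant|reflexivity]. Qed.

Lemma code_computable_and K K' : code_computable K -> code_computable K' ->
  code_computable (fun A => And (K A) (K' A)).
Proof.
  intros (h & Hh & E) (h' & Hh' & E').
  exists (fun n => to_nat (2, to_nat (h n, h' n))). split.
  - auto using computable_pair, computable_constant.
  - intros A. cbn [code]. now rewrite E, E'.
Qed.

Lemma code_computable_imp K K' : code_computable K -> code_computable K' ->
  code_computable (fun A => Imp (K A) (K' A)).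
Proof.
  intros (h & Hh & E) (h' & Hh' & E').
  exists (fun n => to_nat (4, to_nat (h n, h' n))). split.
  - auto using computable_pair, computable_constant.
  - intros A. cbn [code]. now rewrite E, E'.
Qed.

Lemma code_computable_ex x K : code_computable K ->
  code_computable (fun A => Ex x (K A)).
Proof.
  intros (h & Hh & E). exists (fun n => to_nat (6, to_nat (x, h n))). split.
  - auto using computable_pair, computable_constant.
  - intros A. cbn [code]. now rewrite E.
Qed.

#[local] Hint Resolve code_computable_hole code_computable_constant
  code_computable_and code_computable_imp code_computable_ex : computable.

Lemma code_denotes_node (T U : formula -> formula) :
  code_computable T -> code_computable U ->
  code_computable (fun A => denotes_node (T A) (U A)).
Proof. intros HT HU. unfold denotes_node. auto 20 with computable. Qed.

Lemma computable_code_denotes_numeral : computable (fun n => code (denotes (numeral n))).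
Proof.
  destruct (code_denotes_node (fun _ => denotes Leaf) (fun A => A))
    as (h & Hh & E); auto with computable.
  apply computable_rec with h; [|exact Hh]. intros n. apply E.
Qed.

Lemma computable_code_halting f : computable (fun n => code (halting f (tuple [0; n]))).
Proof.
  assert (H : code_computable (fun A =>
    Imp (And (And node_nonleaf node_injective) (And (rules f)
      (Ex 0 (And (atom (Kind (Some f)) 0) (And (atom (Field 1) 0)
        (denotes_node (denotes Leaf) (denotes_node A (denotes Leaf)))))))) falsum)).
  { apply code_computable_imp; auto with computable.
    repeat apply code_computable_and; auto 12 using code_denotes_node with computable. }
  destruct H as (h & Hh & E).
  destruct (computable_comp h _ Hh computable_code_denotes_numeral) as [p Hp].
  exists p. intros n. specialize (Hp n). cbn beta in Hp. rewrite <- E in Hp. exact Hp.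
Qed.

(** * Hardness *)

Theorem theorem8p3 (L : formula -> Prop)
    (L_logic : superintuitionistic L)
    (QLC_L : forall A, QLC A -> L A)
    (L_QSIL : forall A, L A -> QSIL (constant_domain nat_frame nat 0) A) :
  Sigma01_hard (codes (restricted_fragment L)).
Proof.
  intros X (f & [p Hp] & HX).
  exists (fun n => code (halting (search p) (tuple [0; n]))).
  split; [apply computable_code_halting|]. intros n. rewrite HX. split.
  - intros [m Hm]. eexists; split; [|reflexivity].
    destruct (search_runs p f n m Hp Hm) as [k Hk].
    destruct (fragment_halting (search p) (tuple [0; n])) as [Hpos Hvar].
    split; [split|]; auto.
    apply (si_QInt L L_logic). exact (halting_valid _ _ _ _ Hk).
  - intros (A & [[HA _] _] & E). apply code_inj in E. subst A.
    apply NNPP. intros Hno. apply L_QSIL, halting_refuted in HA; [exact HA|].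
    apply (search_diverges p f n Hp). intros m Hm. apply Hno. now exists m.
Qed.
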